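(* Consider the classical risk model, where the claim amounts $X$ have distribution function $F_X$. Assume that $F_X\in C^3([0,\infty))$ and a) $X$ has finite third moment; b) $\lim_{u\downarrow 0}F_X'(u)$ exists and is finite; c) $I_i(F_X'')=\int_0^\infty u^i|F_X''(u)|\,du<\infty$ for $i=0,2$; d) $\|u^2\bar F_X(u)\|<\infty$, and $\|u^2F_X^{(i)}(u)\|<\infty$ for $i=1,2,3$. Let $F$ be the distribution function on $[0,\infty)$ with density $f(u)=\bar F_X(u)/\mu$, let $v(u)=\phi(1-F(u))$, let $Z$ be a random variable with distribution function $F$, and let $$w_1(u)=\phi\,\psi(0)f(u)+v'(u),\qquad w_2(u)=\phi\,\psi'(0)f(u)+w_1'(u),$$ where $\psi$ is the ruin probability. Then the following conditions hold: 1. $Z$ has finite variance. 2. $F$ and $v$ are in $C^2_0([0,\infty))$. 3. $f'$ and $v''$ are in $C^2([0,\infty))$. 4. $I_i(f'')=\int_0^\infty u^i|f''(u)|\,du<\infty$ for $i=0,2$. 5. $\|u^2w_i(u)\|<\infty$ for $i=1,2$. 6. $\|u^2w_i''(u)\|<\infty$ for $i=1,2$.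
   Context: Classical risk model: claims arrive according to a Poisson process $(N(t),\ t\ge 0)$ with intensity $\lambda>0$; the claim amounts $X_1,X_2,\dots$ are i.i.d. positive random variables (generic copy $X$) with distribution function $F_X$ and finite mean $\mu=EX_1>0$, independent of $N$; premiums are received at constant rate $c>0$, and it is assumed that $\phi:=\lambda\mu/c<1$. Write $\bar F_X=1-F_X$. The ruin probability with initial capital $u\ge 0$ is $$\psi(u)=P\Big(\inf_{t\ge 0}\Big(u+ct-\sum_{i=1}^{N(t)}X_i\Big)<0\Big).$$ It is known that $\psi$ is the locally bounded solution of the defective renewal equation $\psi(u)=\phi\int_0^u\psi(u-y)f(y)\,dy+v(u)$, $u\ge 0$, with $f$ and $v$ as in the statement. Function classes: $C^n([0,\infty))$ is the class of continuous real functions on $[0,\infty)$ having continuous $n$-th derivative on $(0,\infty)$; $C^n_0([0,\infty))$ is the subclass of $g\in C^n([0,\infty))$ such that $\lim_{t\downarrow 0}g^{(k)}(t)$ exists and is finite for all $k=0,1,\dots,n$, and then $g^{(k)}(0)$ denotes this limit. Likewise $\psi'(0)=\lim_{u\downarrow 0}\psi'(u)$, which exists when $F,v\in C_0^2([0,\infty))$. $\|\cdot\|$ denotes the supremum norm (over $(0,\infty)$ for expressions involving derivatives defined only there). *)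

(* Defs.v *)
From HB Require Import structures.
From mathcomp Require Import all_boot all_order all_algebra.
From mathcomp Require Import all_classical all_reals all_analysis.

Set Implicit Arguments.
Unset Strict Implicit.
Unset Printing Implicit Defensive.

Import Order.TTheory GRing.Theory Num.Theory.
Import numFieldNormedType.Exports.

Local Open Scope classical_set_scope.
Local Open Scope ring_scope.

Section independence.
Context {d : measure_display} {T : measurableType d} {R : realType}
  (P : probability T R).

Definition mutually_independent (I : eqType) {d' : measure_display}
    {T' : measurableType d'} (Y : I -> T -> T') : Prop :=
  forall (s : seq I) (B : I -> set T'), uniq s ->
    (forall i, measurable (B i)) ->
    P (\big[setI/setT]_(i <- s) (Y i @^-1` B i)) =
    (\prod_(i <- s) P (Y i @^-1` B i))%E.

Definition identically_distributed (I : Type) {d' : measure_display}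
    {T' : measurableType d'} (Y : I -> T -> T') : Prop :=
  forall (i j : I) (B : set T'), measurable B ->
    P (Y i @^-1` B) = P (Y j @^-1` B).

Definition sigma_of_family (I : Type) (D : set I) {d' : measure_display}
    {T' : measurableType d'} (Y : I -> T -> T') : set (set T) :=
  <<s \bigcup_(i in D) preimage_set_system setT (Y i) measurable >>.

Definition independent_sigma (G H : set (set T)) : Prop :=
  forall A B, G A -> H B -> P (A `&` B) = (P A * P B)%E.

End independence.

Section risk_model.
Context {d : measure_display} {T : measurableType d} {R : realType}
  (P : probability T R).

(* Only the times t >= 0 matter; the values [N t] for t < 0 are unconstrained.
   Paths are nondecreasing, so truncated subtraction gives the increments. *)
Record poisson_process (lambda : R) (N : R -> {RV P >-> nat}) : Prop := {
  poisson_start : {ae P, forall w, N 0 w = 0%N} ;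
  poisson_nondecreasing : forall w (s t : R), 0 <= s -> s <= t ->
    (N s w <= N t w)%N ;
  poisson_right_continuous : forall w (t : R), 0 <= t ->
    \forall s \near t^'+, N s w = N t w ;
  poisson_independent_increments : forall t : nat -> R, 0 <= t 0%N ->
    (forall i, t i <= t i.+1) ->
    mutually_independent P
      (fun (i : nat) (w : T) => (N (t i.+1) w - N (t i) w)%N) ;
  poisson_increments : forall s t : R, 0 <= s -> s < t -> forall k : nat,
    P [set w | (N t w - N s w)%N = k] =
    (poisson_pmf (lambda * (t - s)) k)%:E }.

(* [X i] is the amount of the (i+1)-st claim. *)
Record classical_risk_model (lambda c : R) (N : R -> {RV P >-> nat})
    (X : nat -> {RV P >-> R}) : Prop := {
  intensity_gt0 : 0 < lambda ;
  premium_gt0 : 0 < c ;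
  claim_arrivals : poisson_process lambda N ;
  claims_gt0 : forall i, {ae P, forall w, 0 < X i w} ;
  claims_independent :
    mutually_independent P (fun i : nat => X i : T -> R) ;
  claims_identically_distributed :
    identically_distributed P (fun i : nat => X i : T -> R) ;
  arrivals_claims_independent :
    independent_sigma P
      (sigma_of_family [set t : R | 0 <= t] (fun t => N t : T -> nat))
      (sigma_of_family [set: nat] (fun i => X i : T -> R)) ;
  claims_integrable : P.-integrable setT (EFin \o X 0%N) ;
  claims_mean_gt0 : 0 < fine 'E_P[X 0%N] ;
  loading : lambda * fine 'E_P[X 0%N] / c < 1 }.

Definition surplus (c : R) (N : R -> {RV P >-> nat}) (X : nat -> {RV P >-> R})
    (u t : R) (w : T) : R :=
  u + c * t - \sum_(0 <= i < N t w) X i w.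

Definition ruin_probability (c : R) (N : R -> {RV P >-> nat})
    (X : nat -> {RV P >-> R}) (u : R) : R :=
  fine (P [set w | (ereal_inf
    [set (surplus c N X u t w)%:E | t in [set t : R | (0 <= t)%R]] < 0)%E]).

End risk_model.

(* Functions on [0, +oo[ are represented by functions on R whose values on
   ]-oo, 0[ are irrelevant. *)
Section function_classes.
Context {R : realType}.
Implicit Types (n : nat) (g : R -> R).

(* The n-th derivative on ]0, +oo[, extended to 0 by its right limit. *)
Definition ext_deriv n g (u : R) : R :=
  if 0 < u then derive1n n g u else lim (derive1n n g x @[x --> 0^'+]).

Definition Cn n g : Prop :=
  [/\ {within `[0, +oo[, continuous g},
      forall k, (k < n)%N -> forall x, 0 < x -> derivable (derive1n k g) x 1 &
      forall x, 0 < x -> {for x, continuous (derive1n n g)}].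

Definition Cn0 n g : Prop :=
  Cn n g /\ forall k, (k <= n)%N -> cvg (derive1n k g x @[x --> 0^'+]).

Definition abs_moment n g : \bar R :=
  (\int[lebesgue_measure]_(u in `]0%R, +oo[) (u ^+ n * `|g u|)%:E)%E.

Definition sup_norm (D : set R) g : \bar R :=
  ereal_sup [set `|g u|%:E | u in D].

End function_classes.

(* Main.v *)
(* On ]0, +oo[ all functions involved are linear combinations of the constant 1
   and derivatives of F_X: f = (1 - F_X)/mu, F' = f, v' = - phi f,
   w1 = phi (psi(0) - 1) f and w2 = phi psi'(0) f + w1'; the numbers psi(0) and
   psi'(0) may be arbitrary. This gives everything except the variance of Z.

   For the variance, f is nonincreasing, so P(n < Z <= n+1) = F(n+1) - F(n) is
   at most f(n) = P(X > n)/mu, and E[Z^2] <= sum_n (n+1)^2 P(n < Z <= n+1) is at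
   most the expectation of mu^-1 sum_{n < X} (n+1)^2 <= mu^-1 (|X| + 1)^3. *)

Require Import Defs.
From HB Require Import structures.
From mathcomp Require Import all_boot all_order all_algebra.
From mathcomp Require Import all_classical all_reals all_analysis.
From mathcomp Require Import measurable_realfun ring lra.

Import Order.TTheory GRing.Theory Num.Theory.
Import numFieldNormedType.Exports.

Local Open Scope classical_set_scope.
Local Open Scope ring_scope.

(** * Calculus of the classes [Cn], of [ext_deriv] and of the two norms on the open half-line *)

Section half_line_calculus.
Context {R : realType}.
Implicit Types (g h : R -> R) (a b x y u : R) (k m n : nat).

(** The differentiability clause of [Cn], isolated because linearity of iterated derivatives rests
    on it alone. *)
Definition derivable_pos n g : Prop :=
  forall k, (k < n)%N -> forall x, 0 < x -> derivable (derive1n k g) x 1.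

Lemma near_eq_pos g h x :
  (forall y, 0 < y -> g y = h y) -> 0 < x -> {near x, g =1 h}.
Proof.
by move=> gh x0; near do apply: gh; exact: lt_nbhsr.
Unshelve. all: by end_near. Qed.

(** The open half-line is a neighbourhood of each of its points, so derivatives there ignore the
    irrelevant values at the other reals. All later rewriting of derivatives goes through this. *)
Lemma eq_derive1n_pos g h k : (forall y, 0 < y -> g y = h y) ->
  forall x, 0 < x -> derive1n k g x = derive1n k h x.
Proof.
move=> gh; elim: k => [|k ih] x x0; first exact: gh.
rewrite !derive1nS !derive1E.
by apply: near_eq_derive; exact: near_eq_pos.
Qed.

(** The order [k = n] is included: each induction step differentiates derivatives of order below [n]
    only. *)
Lemma derive1n_lin n a b g h : derivable_pos n g -> derivable_pos n h ->
  forall k x, (k <= n)%N -> 0 < x ->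
  derive1n k (fun u => a * g u + b * h u) x =
  a * derive1n k g x + b * derive1n k h x.
Proof.
move=> dg dh; elim=> // k ih x kn x0; rewrite !derive1nS.
transitivity (derive1 (a *: derive1n k g + b *: derive1n k h) x).
  by apply: (@eq_derive1n_pos _ _ 1) => // y y0; rewrite ih// ltnW.
rewrite !derive1E deriveD; first by rewrite !deriveZ//; [exact: dh|exact: dg].
- exact/derivableZ/dg.
- exact/derivableZ/dh.
Qed.

Lemma derivable_pos_lin n a b g h : derivable_pos n g -> derivable_pos n h ->
  derivable_pos n (fun u => a * g u + b * h u).
Proof.
move=> dg dh k kn x x0.
apply: (@near_eq_derivable _ _ _ (a *: derive1n k g + b *: derive1n k h)).
- apply: near_eq_pos => // y y0.
  by rewrite (derive1n_lin n)// ltnW.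
- by apply: derivableD; apply: derivableZ; [exact: dg|exact: dh].
Qed.

Lemma derivable_posS n g : (forall x, 0 < x -> derivable g x 1) ->
  derivable_pos n (derive1 g) -> derivable_pos n.+1 g.
Proof.
move=> dg dg' [|k] kn x x0; first exact: dg.
by rewrite derive1Sn; exact: dg'.
Qed.

Lemma eq_derivable_pos n g h : (forall x, 0 < x -> g x = h x) ->
  derivable_pos n g -> derivable_pos n h.
Proof.
move=> gh dg k kn x x0.
apply: (@near_eq_derivable _ _ _ (derive1n k g)).
- by apply: near_eq_pos => // y y0; exact: eq_derive1n_pos.
- exact: dg.
Qed.

Lemma derive1n_cst k a : derive1n k.+1 (cst a) = cst 0.
Proof.
elim: k => [|k ih]; first by apply/funext => x; rewrite derive1n1 derive1_cst.
by rewrite derive1nS ih; apply/funext => x; rewrite derive1_cst.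
Qed.

Lemma derivable_pos_le m n g :
  (m <= n)%N -> derivable_pos n g -> derivable_pos m g.
Proof. by move=> mn dg k km; apply: dg; exact: leq_trans km mn. Qed.

Lemma derivable_derive1n_continuous n g k x : derivable_pos n g ->
  (k < n)%N -> 0 < x -> {for x, continuous (derive1n k g)}.
Proof.
move=> dg kn x0.
exact/differentiable_continuous/derivable1_diffP/dg.
Qed.

Lemma Cn_le m n g : (m <= n)%N -> Cn n g -> Cn m g.
Proof.
move=> mn [cg dg cdg]; split; [exact: cg|exact: derivable_pos_le dg|].
move: mn; rewrite leq_eqVlt => /predU1P[->//|mn] x x0.
exact: derivable_derive1n_continuous dg mn x0.
Qed.

Lemma Cn_derivable_pos n g : Cn n g -> derivable_pos n g.
Proof. by case. Qed.

Lemma Cn_continuous n g k x :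
  Cn n g -> (k <= n)%N -> 0 < x -> {for x, continuous (derive1n k g)}.
Proof. by move=> Cg kn x0; have [_ _] := Cn_le k n g kn Cg; apply. Qed.

Lemma Cn_cst n a : Cn n (cst a : R -> R).
Proof.
split=> [|k _ x _|x _].
- exact/continuous_subspaceT/cst_continuous.
- by case: k => [|k]; rewrite ?derive1n_cst; exact: derivable_cst.
- by case: n => [|n]; rewrite ?derive1n_cst; exact: cst_continuous.
Qed.

Lemma Cn_lin n a b g h :
  Cn n g -> Cn n h -> Cn n (fun u => a * g u + b * h u).
Proof.
move=> [cg dg cdg] [ch dh cdh]; split; last 1 first.
- move=> x x0; rewrite /prop_for /continuous_at.
  have lin y : 0 < y -> _ := derive1n_lin n a b g h dg dh n y (leqnn n).
  rewrite lin//; apply: cvg_trans (_ :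
    a * derive1n n g y + b * derive1n n h y @[y --> x] --> _).
    by apply/near_eq_cvg/near_eq_pos => [y y0|//]; rewrite lin.
  by apply: cvgD; apply: cvgM;
    [exact: cvg_cst|exact: cdg|exact: cvg_cst|exact: cdh].
- move=> x; apply: cvgD; apply: cvgM;
    [exact: cvg_cst|exact: cg|exact: cvg_cst|exact: ch].
- exact: derivable_pos_lin dg dh.
Qed.

Lemma CnS n g f : {within `[0, +oo[, continuous g} ->
  (forall x, 0 < x -> derivable g x 1) ->
  (forall x, 0 < x -> derive1 g x = f x) -> Cn n f -> Cn n.+1 g.
Proof.
move=> cg dg g'f [cf df cdf].
have gfE x : 0 < x -> derive1n n.+1 g x = derive1n n f x.
  by rewrite derive1Sn; exact: eq_derive1n_pos.
split; first exact: cg.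
- apply: derivable_posS; first exact: dg.
  by apply: eq_derivable_pos df => x x0; rewrite g'f.
- move=> x x0; rewrite /prop_for /continuous_at gfE//.
  apply: cvg_trans (cdf _ x0); apply/near_eq_cvg/near_eq_pos => [y y0|//].
  by rewrite gfE.
Qed.

Lemma ext_deriv_pos n g x : 0 < x -> ext_deriv n g x = derive1n n g x.
Proof. by move=> x0; rewrite /ext_deriv x0. Qed.

Lemma near_at_right0 g h :
  (forall x, 0 < x -> g x = h x) -> \forall x \near 0^'+, g x = h x.
Proof.
by move=> gh; near do apply: gh; exact: nbhs_right_gt.
Unshelve. all: by end_near. Qed.

Lemma cvg_right0_eq g h (l : set_system R) : (forall x, 0 < x -> g x = h x) ->
  h x @[x --> 0^'+] --> l -> g x @[x --> 0^'+] --> l.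
Proof.
move=> gh; apply: cvg_trans; apply: near_eq_cvg.
by apply: near_at_right0 => x x0; rewrite gh.
Qed.

Lemma is_cvg_right0_eq g h : (forall x, 0 < x -> g x = h x) ->
  cvg (h x @[x --> 0^'+]) -> cvg (g x @[x --> 0^'+]).
Proof.
by move=> gh /cvg_ex[l hl]; apply/cvg_ex; exists l; exact: cvg_right0_eq hl.
Qed.

Lemma ext_derivE0 n g h l : h x @[x --> 0^'+] --> l ->
  (forall x, 0 < x -> derive1n n g x = h x) -> ext_deriv n g 0 = l.
Proof.
move=> hl gh; rewrite /ext_deriv ltxx; apply: cvg_lim => //.
exact: cvg_right0_eq hl.
Qed.

(** Away from 0, [ext_deriv] is the derivative itself and inherits its regularity, with [n] orders
    spent. At 0 its value is by definition the right limit, so convergence there is exactly right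
    continuity. *)
Lemma Cn_ext_deriv m n g : Cn (n + m) g ->
  cvg (derive1n n g x @[x --> 0^'+]) -> Cn m (ext_deriv n g).
Proof.
move=> Cg cvg0; have e x : 0 < x -> derive1n n g x = ext_deriv n g x.
  by move=> x0; rewrite ext_deriv_pos.
have iterD k : derive1n k (derive1n n g) = derive1n (k + n) g.
  by rewrite /derive1n iterD.
split.
- apply/continuous_within_itvcyP; split.
  + move=> x; rewrite in_itv/= andbT => x0; rewrite /continuous_at -e//.
    apply: cvg_trans (Cn_continuous _ _ _ _ Cg (leq_addr _ _) x0).
    exact/near_eq_cvg/near_eq_pos.
  + rewrite {2}/ext_deriv ltxx.
    by apply: cvg_right0_eq cvg0 => x x0; rewrite e.
- apply: (eq_derivable_pos _ _ _ e) => k km x x0; rewrite iterD.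
  by apply: (Cn_derivable_pos _ _ Cg); rewrite // addnC ltn_add2l.
- move=> x x0; rewrite /prop_for /continuous_at.
  rewrite -(eq_derive1n_pos _ _ _ e)// iterD addnC.
  apply: cvg_trans (Cn_continuous _ _ _ _ Cg (leqnn _) x0).
  apply: near_eq_cvg; apply: near_eq_pos => // y y0.
  by rewrite -(eq_derive1n_pos _ _ _ e)// iterD addnC.
Qed.

Lemma sup_norm_ltyP (D : set R) g : (sup_norm D g < +oo)%E <->
  exists M, forall u, D u -> `|g u| <= M.
Proof.
split=> [gy|[M gM]]; last first.
  apply: (@le_lt_trans _ _ M%:E); last exact: ltry.
  by apply: ge_ereal_sup => _ [u Du <-]; rewrite lee_fin gM.
exists (fine (sup_norm D g)) => u Du.
have gu : (`|g u|%:E <= sup_norm D g)%E by apply: ereal_sup_ubound; exists u.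
by rewrite -lee_fin fineK// ge0_fin_numE//; exact: le_trans gu.
Qed.

Lemma sup_norm_lin_lty (D : set R) a b g h p :
  (sup_norm D g < +oo)%E -> (sup_norm D h < +oo)%E ->
  (forall u, D u -> p u = a * g u + b * h u) -> (sup_norm D p < +oo)%E.
Proof.
move=> /sup_norm_ltyP[M gM] /sup_norm_ltyP[L hL] pE; apply/sup_norm_ltyP.
exists (`|a| * M + `|b| * L) => u Du; rewrite pE//.
by rewrite (le_trans (ler_normD _ _))// !normrM lerD// ler_wpM2l// ?gM ?hL.
Qed.

(** Continuity of [g] supplies the measurability needed to pull the constant [|a|] out of the
    integral. *)
Lemma abs_momentZ_lty n a g h : (forall x, 0 < x -> {for x, continuous g}) ->
  (forall x, 0 < x -> h x = a * g x) ->
  (abs_moment n g < +oo)%E -> (abs_moment n h < +oo)%E.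
Proof.
move=> cg hE gy; rewrite /abs_moment.
have mg : measurable_fun (`]0, +oo[ : set R) g.
  apply: subspace_continuous_measurable_fun => //.
  apply: continuous_in_subspaceT => x.
  by rewrite inE/= in_itv/= andbT; exact: cg.
under eq_integral => x.
  rewrite inE/= in_itv/= andbT => x0.
  rewrite hE// normrM mulrCA EFinM.
  over.
rewrite ge0_integralZl//.
- by rewrite lte_mul_pinfty.
- apply/measurable_EFinP/measurable_funM; first exact: exprn_measurable.
  exact: measurableT_comp.
- move=> x /=; rewrite in_itv/= andbT => x0.
  by rewrite lee_fin mulr_ge0// exprn_ge0// ltW.
Qed.

Lemma Cn_cvg0 n g : Cn n g -> g x @[x --> 0^'+] --> g 0.
Proof. by move=> [/continuous_within_itvcyP[]]. Qed.

Lemma gt0_itvoy u : `]0, +oo[%classic u -> 0 < u.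
Proof. by rewrite /= in_itv/= andbT. Qed.

(** A single point adds one finite value to the supremum. This serves functions known by a formula
    on the open half-line only, such as [w2]. *)
Lemma sup_norm_adjoin0_lty g :
  (sup_norm `]0%R, +oo[ g < +oo)%E -> (sup_norm `[0%R, +oo[ g < +oo)%E.
Proof.
move=> /sup_norm_ltyP[M gM]; apply/sup_norm_ltyP.
exists (Num.max M `|g 0|) => u /=; rewrite in_itv/= andbT le_eqVlt.
move=> /predU1P[<-|u0]; first by rewrite le_max lexx orbT.
by rewrite le_max gM//= in_itv/= u0.
Qed.

Lemma sup_normS_lty (D E : set R) g : D `<=` E ->
  (sup_norm E g < +oo)%E -> (sup_norm D g < +oo)%E.
Proof.
move=> DE; apply: le_lt_trans; apply: ereal_sup_le => _ [u /DE Eu <-].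
by exists u.
Qed.

End half_line_calculus.

(** * The primitive of a function continuous on the closed half-line *)

Section primitive.
Context {R : realType} (f : R -> R) (cf : {within `[0, +oo[, continuous f}).

Let F (u : R) : R := \int[lebesgue_measure]_(y in `[0, u]) f y.

Lemma integrable_within_itv0 (u : R) :
  lebesgue_measure.-integrable `[0, u] (EFin \o f).
Proof.
apply: continuous_compact_integrable; first exact: segment_compact.
by apply: continuous_subspaceW cf; exact: subset_itvl.
Qed.

Lemma derivable_primitive (x : R) : 0 < x ->
  derivable F x 1 /\ derive1 F x = f x.
Proof.
move=> x0; apply: (@continuous_FTC1_closed _ f 0 x (x + 1)) => //.
- by rewrite ltrDl.
- exact: integrable_within_itv0.
- move/continuous_within_itvcyP : cf => [+ _]; apply.
  by rewrite in_itv/= x0.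
Qed.

Lemma primitive0 : F 0 = 0.
Proof. by rewrite /F set_itv1 Rintegral_set1. Qed.

Lemma primitive_continuous : {within `[0, +oo[, continuous F}.
Proof.
apply/continuous_within_itvcyP; split.
- move=> x; rewrite in_itv/= andbT => x0.
  exact/differentiable_continuous/derivable1_diffP/(derivable_primitive x x0).1.
- have := @parameterized_integral_continuous R 0 1 f ler01
    (integrable_within_itv0 1).
  by move=> /(continuous_within_itvP _ ltr01)[].
Qed.

(** The mean value theorem gives the increment as [f c * (b - a)] with [a < c], and monotonicity
    bounds [f c] by [f a]. *)
Lemma primitive_incr_le (a b : R) : 0 <= a -> a < b ->
  {in `[0, +oo[ &, {homo f : x y / x <= y >-> y <= x}} ->
  F b - F a <= f a * (b - a).
Proof.
move=> a0 ab fni.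
have pos (x : R) : x \in `]a, b[ -> 0 < x.
  by rewrite in_itv/= => /andP[+ _]; exact: le_lt_trans.
have [||c cab ->] := @MVT _ F f a b ab.
- move=> x /pos x0; have [dF F'] := derivable_primitive x x0.
  by apply: DeriveDef; [exact: dF|rewrite -derive1E].
- apply: continuous_subspaceW primitive_continuous.
  move=> x /=; rewrite !in_itv/= andbT => /andP[+ _]; exact: le_trans.
rewrite ler_wpM2r ?subr_ge0 ?(ltW ab)//.
move: (cab); rewrite in_itv/= => /andP[ac _].
apply: fni (ltW ac); rewrite in_itv/= andbT//.
by rewrite ltW// pos.
Qed.

End primitive.

(** * Sums over the unit cells []n, n+1]] *)

Section unit_interval_sums.
Context {R : realType}.

Lemma sum_sqr_indic_le (x : R) n :
  \sum_(0 <= k < n) k.+1%:R ^+ 2 * (k%:R < x)%R%:R <= 4 * (`|x| ^+ 3 + 1) :> R.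
Proof.
(* Two bounds are carried through the induction. While [n < x], the first one grows by
   [n^3 + (n+1)^2 <= (n+1)^3] and yields the second, since then [n + 1 <= |x| + 1]. Once [x <= n],
   the added term vanishes. *)
suff : \sum_(0 <= k < n) k.+1%:R ^+ 2 * (k%:R < x)%R%:R <= n%:R ^+ 3 :> R /\
   \sum_(0 <= k < n) k.+1%:R ^+ 2 * (k%:R < x)%R%:R <= (`|x| + 1) ^+ 3 :> R.
  move=> [_ /le_trans]; apply.
  have : 0 <= `|x| by [].
  move: (`|x|) => y y0; rewrite -subr_ge0.
  (* This factorization is the source of the constant 4. *)
  have -> : 4 * (y ^+ 3 + 1) - (y + 1) ^+ 3 = 3 * ((y - 1) ^+ 2 * (y + 1)).
    by ring.
  by rewrite mulr_ge0// mulr_ge0 ?sqr_ge0// addr_ge0.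
elim: n => [|n [ih1 ih2]].
  by rewrite big_geq// expr0n exprn_ge0// addr_ge0.
have n0 : 0 <= n%:R :> R by [].
rewrite big_nat_recr//=; case: ltP => nx; last first.
  rewrite mulr0 addr0; split=> //; apply: le_trans ih1 _.
  by rewrite lerXn2r ?nnegrE// ler_nat.
rewrite mulr1.
have h : n%:R ^+ 3 + n.+1%:R ^+ 2 <= n.+1%:R ^+ 3 :> R.
  by rewrite -!natr1; nra.
have h1 := le_trans (lerD ih1 (lexx _)) h.
split=> //; apply: le_trans h1 _; rewrite lerXn2r ?nnegrE ?addr_ge0//.
by rewrite -natr1 lerD2r (le_trans (ltW nx))// ler_norm.
Qed.

(** Monotone convergence for nonnegative terms. It is applied twice: to the cells of [Z] and to the
    tails of [X]. *)
Lemma integral_indic_series {e} {S : measurableType e}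
    (mu : {measure set S -> \bar R}) (A : nat -> set S) (c : R^nat) :
  (forall n, measurable (A n)) -> (forall n, 0 <= c n) ->
  (\int[mu]_w (\sum_(n <oo) (c n * \1_(A n) w)%:E) =
   \sum_(n <oo) (c n)%:E * mu (A n))%E.
Proof.
move=> mA c0; rewrite integral_nneseries//.
- apply: eq_eseriesr => n _.
  under eq_integral do rewrite EFinM.
  rewrite ge0_integralZl//; first by rewrite integral_indic// setIT.
  + by apply/measurable_EFinP; exact: measurable_indic.
  + by rewrite lee_fin.
- by move=> n; apply/measurable_EFinP/measurable_funM.
- by move=> n w _; rewrite lee_fin mulr_ge0 ?c0.
Qed.

(** The least natural number above [x] is nonzero because [x] is positive; its predecessor is [n].
    Hence the cells cover the open half-line. *)
Lemma ceil_nat (x : R) : 0 < x -> exists n : nat, n%:R < x <= n.+1%:R.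
Proof.
move=> x0; have ex : exists m : nat, x <= m%:R.
  by exists (Num.bound x); exact/ltW/archi_boundP/ltW.
case: (ex_minnP ex) => -[|n]; first by rewrite leNgt x0.
move=> xn min; exists n; rewrite xn andbT ltNge; apply/negP => /min.
by rewrite ltnn.
Qed.

End unit_interval_sums.

(** * Second moment of [Z] from the third absolute moment of [X] *)

Section second_moment.
Context {R : realType} {d : measure_display} {T : measurableType d}
  (P : probability T R) (X : {RV P >-> R})
  {d' : measure_display} {T' : measurableType d'} (Q : probability T' R)
  (Z : {RV Q >-> R}).

Lemma second_moment_lty (C : R) : 0 <= C ->
  (Q (Z @^-1` `]-oo, 0%R]) = 0)%E ->
  (forall n : nat, Q (Z @^-1` `]n%:R%R, n.+1%:R%R]) <=
     C%:E * P (X @^-1` `]n%:R%R, +oo[))%E ->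
  ('E_P[(fun w => `|X w| ^+ 3)%R] < +oo)%E ->
  (\int[Q]_w (Z w ^+ 2)%:E < +oo)%E.
Proof.
move=> C0 Z0 ZX X3.
pose A n : set T' := Z @^-1` `]n%:R, n.+1%:R].
pose B n : set T := X @^-1` `]n%:R, +oo[.
have mA n : measurable (A n) by rewrite -[A n]setTI; exact: measurable_funP.
have mB n : measurable (B n) by rewrite -[B n]setTI; exact: measurable_funP.
pose c n : R := n.+1%:R ^+ 2.
have mX3 : measurable_fun setT (fun w => (`|X w| ^+ 3)%:E).
  exact/measurable_EFinP/measurable_funX/measurableT_comp.
have c0 n : 0 <= c n by exact: sqr_ge0.
apply: (@le_lt_trans _ _ (\int[Q]_w (\sum_(n <oo) (c n * \1_(A n) w)%:E))%E).
  apply: ae_ge0_le_integral => //.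
  - by move=> w _; rewrite lee_fin sqr_ge0.
  - apply/measurable_EFinP/measurable_funX; exact: measurable_funP.
  - by move=> w _; apply: nneseries_ge0 => n _ _; rewrite lee_fin mulr_ge0.
  - apply: ge0_emeasurable_sum => //.
    + by move=> n w _ _; rewrite lee_fin mulr_ge0.
    + by move=> n _; apply/measurable_EFinP/measurable_funM.
  (* The pointwise bound is claimed off this null set: where [Z <= 0] no cell contains [Z], and the
     series is 0. *)
  exists (Z @^-1` `]-oo, 0]); split => //.
    by rewrite -[_ @^-1` _]setTI; exact: measurable_funP.
  move=> w /= nle; rewrite in_itv/= leNgt; apply/negP => Zw0; apply: nle => _.
  have [n nZ] := ceil_nat _ Zw0.
  (* The partial sum stops at [n.+1] so that its last term is that of index [n], whose cell contains
     [Z w] and whose weight [(n+1)^2] dominates [Z w ^+ 2]. *)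
  apply: le_trans (nneseries_lim_ge n.+1 _); last first.
    by move=> k _ _; rewrite lee_fin mulr_ge0.
  rewrite big_nat_recr//=; apply: (@le_trans _ _ (c n * \1_(A n) w)%:E).
    rewrite lee_fin indicE mem_set ?mulr1; last by rewrite /A /= in_itv.
    by case/andP: nZ => _ Zn; rewrite /c lerXn2r ?nnegrE// ltW.
  rewrite leeDr// sume_ge0// => k _.
  by rewrite lee_fin mulr_ge0.
rewrite integral_indic_series//.
apply: (@le_lt_trans _ _
  (C%:E * \int[P]_w (\sum_(n <oo) (c n * \1_(B n) w)%:E))%E).
  rewrite integral_indic_series// -nneseriesZl; last first.
    by move=> n _; rewrite mule_ge0// lee_fin.
  apply: lee_nneseries => [n _ _|n _]; first by rewrite mule_ge0// lee_fin.
  by rewrite muleCA lee_wpmul2l ?lee_fin//; exact: ZX.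
rewrite lte_mul_pinfty// ?lee_fin//.
apply: (@le_lt_trans _ _ (\int[P]_w (4%:E * ((`|X w| ^+ 3)%:E + 1)))%E).
  apply: ge0_le_integral => //.
  - by move=> w _; apply: nneseries_ge0 => n _ _; rewrite lee_fin mulr_ge0.
  - apply: ge0_emeasurable_sum => //.
    + by move=> n w _ _; rewrite lee_fin mulr_ge0.
    + by move=> n _; apply/measurable_EFinP/measurable_funM.
  - by apply: measurable_funeM; exact: emeasurable_funD.
  (* The cubic bound does not depend on the number of terms, so it passes to the limit of the
     partial sums. *)
  move=> w _; apply: lime_le.
    by apply: is_cvg_nneseries => n _ _; rewrite lee_fin mulr_ge0.
  apply: nearW => n; rewrite sumEFin -EFinD -EFinM lee_fin.
  apply: (le_trans _ (sum_sqr_indic_le (X w) n)).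
  rewrite le_eqVlt; apply/orP; left; apply/eqP; apply: eq_bigr => k _.
  rewrite /c indicE /B; congr (_ * (nat_of_bool _)%:R).
  by apply/idP/idP; rewrite inE/= in_itv/= andbT.
rewrite ge0_integralZl//; last 2 first.
- exact: emeasurable_funD.
- by move=> w _; rewrite adde_ge0// lee_fin.
rewrite lte_mul_pinfty//.
rewrite ge0_integralD//.
rewrite [X in (_ + X)%E](_ : _ = 1%E); last first.
  by rewrite integral_cst// mul1e; exact: probability_setT.
apply: lte_add_pinfty; last exact: ltry.
by move: X3; rewrite unlock.
Qed.

End second_moment.

(** * Variance from the second moment; cell probabilities from the distribution function *)

Section variance_cdf.
Context {R : realType} {d : measure_display} {T : measurableType d}
  (P : probability T R) (X : {RV P >-> R}).

Lemma variance_lty : (\int[P]_w (X w ^+ 2)%:E < +oo)%E -> ('V_P[X] < +oo)%E.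
Proof.
move=> X2; rewrite /variance unlock; set m := fine _.
have mX2 : measurable_fun setT (fun w => (X w ^+ 2)%:E).
  by apply/measurable_EFinP/measurable_funX.
rewrite unlock; apply: (@le_lt_trans _ _
  (\int[P]_w (2%:E * (X w ^+ 2)%:E + (2 * m ^+ 2)%:E))%E).
  apply: ge0_le_integral => //.
  - by move=> w _; rewrite lee_fin -expr2 sqr_ge0.
  - by apply/measurable_EFinP; apply: measurable_funM; apply: measurable_funB.
  - by apply: emeasurable_funD => //; exact: measurable_funeM.
  - move=> w _; rewrite -EFinM -EFinD lee_fin -subr_ge0 /=.
    (* The bound [(X - m)^2 <= 2 X^2 + 2 m^2] holds because the difference of its sides is this
       square. *)
    rewrite [leRHS](_ : _ = (X w + m) ^+ 2) ?sqr_ge0// !fctE/=; ring.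
rewrite ge0_integralD//; first last.
- by move=> w _; rewrite lee_fin mulr_ge0 ?sqr_ge0.
- by apply: measurable_funeM.
- by move=> w _; rewrite mule_ge0 ?lee_fin ?sqr_ge0.
apply: lte_add_pinfty; last first.
  rewrite integral_cst//; rewrite [X in (_ * X)%E](_ : _ = 1%E) ?mule1 ?ltry//.
  exact: probability_setT.
rewrite ge0_integralZl//; last by move=> w _; rewrite lee_fin sqr_ge0.
by rewrite lte_mul_pinfty.
Qed.

Lemma cdf_itvoc (a b : R) : a <= b ->
  P (X @^-1` `]a, b]) = (cdf X b - cdf X a)%E.
Proof.
move=> ab; rewrite /cdf.
have -> : `]-oo, b]%classic = `]-oo, a] `|` `]a, b].
  by rewrite -itv_bndbnd_setU.
rewrite measureU//.
  by rewrite [X in (X - _)%E]addeC addeK ?fin_num_measure.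
rewrite -subset0 => x [] /=; rewrite !in_itv/= => xa /andP[ax _].
by move: (lt_le_trans ax xa); rewrite ltxx.
Qed.

End variance_cdf.

(** * Regularity and weighted bounds for [f], [F], [v], [w1] and [w2] *)

Section net_claim_functions.
Context {R : realType} (G : R -> R) (mu phi p q : R).

(** [G] stands for the claim distribution function, [p] and [q] for the values of the ruin
    probability and its derivative at 0. *)
Let f (u : R) : R := (1 - G u) / mu.
Let F (u : R) : R := \int[lebesgue_measure]_(y in `[0, u]) f y.
Let v (u : R) : R := phi * (1 - F u).
Let w1 (u : R) : R := phi * p * f u + ext_deriv 1 v u.
Let w2 (u : R) : R := phi * q * f u + ext_deriv 1 w1 u.

Context (C3G : Cn 3 G) (cvgG' : cvg (derive1 G x @[x --> 0^'+])).

Let fE : f = (fun u => - mu^-1 * G u + mu^-1 * cst 1 u).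
Proof. by apply/funext => u; rewrite /f/=; ring. Qed.

Lemma Cn_density : Cn 3 f.
Proof. by rewrite fE; apply: Cn_lin; [exact: C3G|exact: Cn_cst]. Qed.

Lemma derive1n_density k (x : R) : (k < 3)%N -> 0 < x ->
  derive1n k.+1 f x = - mu^-1 * derive1n k.+1 G x.
Proof.
move=> k3 x0; rewrite fE (derive1n_lin 3 _ _ _ _ _ _ k.+1 x k3 x0).
- by rewrite derive1n_cst/= mulr0 addr0.
- exact: Cn_derivable_pos C3G.
- exact/Cn_derivable_pos/Cn_cst.
Qed.

Let cf : {within `[0, +oo[, continuous f}.
Proof. by case: Cn_density. Qed.

(** Integration raises the order of [f] by one. The same order for [v] leaves two derivatives to
    spare after [v'']. *)
Let C4F : Cn 4 F.
Proof.
apply: (CnS 3 F f).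
- exact: primitive_continuous.
- by move=> x /(derivable_primitive f cf)[].
- by move=> x /(derivable_primitive f cf)[].
- exact: Cn_density.
Qed.

Let vE : v = (fun u => phi * cst 1 u + (- phi) * F u).
Proof. by apply/funext => u; rewrite /v/=; ring. Qed.

Let C4v : Cn 4 v.
Proof. by rewrite vE; apply: Cn_lin; [exact: Cn_cst|exact: C4F]. Qed.

Let dFE k (x : R) : 0 < x -> derive1n k.+1 F x = derive1n k f x.
Proof.
move=> x0; rewrite derive1Sn; apply: eq_derive1n_pos => // y.
by move=> /(derivable_primitive f cf)[].
Qed.

Let dvE k (x : R) : (k < 4)%N -> 0 < x ->
  derive1n k.+1 v x = - phi * derive1n k f x.
Proof.
move=> k4 x0; rewrite vE (derive1n_lin 4 _ _ _ _ _ _ k.+1 x k4 x0).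
- by rewrite derive1n_cst dFE//= mulr0 add0r.
- exact/Cn_derivable_pos/Cn_cst.
- exact/Cn_derivable_pos/C4F.
Qed.

Let cvgf : f x @[x --> 0^'+] --> f 0.
Proof. exact: Cn_cvg0 Cn_density. Qed.

Let cvgf' : cvg (derive1n 1 f x @[x --> 0^'+]).
Proof.
apply: (is_cvg_right0_eq _ (fun x => - mu^-1 * derive1 G x)).
  by move=> x x0; exact: derive1n_density.
by apply: is_cvgM => //; exact: is_cvg_cst.
Qed.

(** The right limits at 0 of [F] and [F' = f] come from continuity; that of [F'' = f'] comes from
    the assumed limit of [G']. *)
Lemma Cn0_distribution : Cn0 2 F.
Proof.
split; first exact: Cn_le _ C4F.
move=> [|[|[|k]]] k2; last by case: (notF k2).
- by apply/cvg_ex; exists (F 0); exact: Cn_cvg0 C4F.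
- by apply/cvg_ex; exists (f 0); apply: cvg_right0_eq cvgf => x x0; exact: dFE.
- by apply: is_cvg_right0_eq cvgf' => x x0; exact: dFE.
Qed.

Lemma Cn0_tail : Cn0 2 v.
Proof.
split; first exact: Cn_le _ C4v.
move=> [|k] k2.
  by apply/cvg_ex; exists (v 0); exact: Cn_cvg0 C4v.
apply: (is_cvg_right0_eq _ (fun x => - phi * derive1n k f x)).
  by move=> x x0; apply: dvE => //; exact: leq_trans k2 _.
apply: is_cvgM; first exact: is_cvg_cst.
case: k k2 => [|[|k]] k2; last by case: (notF k2).
  by apply/cvg_ex; exists (f 0); exact: cvgf.
exact: cvgf'.
Qed.

Lemma Cn_density' : Cn 2 (ext_deriv 1 f).
Proof. apply: Cn_ext_deriv; [exact: Cn_density|exact: cvgf']. Qed.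

Lemma Cn_tail'' : Cn 2 (ext_deriv 2 v).
Proof. apply: Cn_ext_deriv; [exact: C4v|exact: Cn0_tail.2]. Qed.

Lemma abs_moment_density'' n :
  (abs_moment n (derive1n 2 G) < +oo)%E ->
  (abs_moment n (derive1n 2 f) < +oo)%E.
Proof.
apply: (abs_momentZ_lty _ (- mu^-1)) => x x0; last exact: derive1n_density.
exact: Cn_continuous C3G _ _.
Qed.

Let A := phi * p - phi.

(** Since [v' = - phi f], the two coefficients of [f] add up to [A]. The point 0 is covered because
    the right limit of [- phi f] is [- phi f 0]. *)
Let w1E (u : R) : 0 <= u -> w1 u = A * f u.
Proof.
rewrite le_eqVlt => /predU1P[<-|u0]; rewrite /w1.
  rewrite (ext_derivE0 1 v (fun x => - phi * f x) (- phi * f 0)).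
  - by rewrite /A; ring.
  - by apply: cvgM; [exact: cvg_cst|exact: cvgf].
  - by move=> x x0; exact: dvE.
by rewrite ext_deriv_pos// dvE//= /A; ring.
Qed.

Let dw1E k (x : R) : 0 < x -> (k <= 3)%N ->
  derive1n k w1 x = A * derive1n k f x.
Proof.
(* The zero term only brings [w1] into the shape of [derive1n_lin]. *)
move=> x0 k3; rewrite (eq_derive1n_pos w1 (fun u => A * f u + 0 * f u))//.
  have df := Cn_derivable_pos _ _ Cn_density.
  by rewrite (derive1n_lin 3 _ _ _ _ df df k x k3 x0) mul0r addr0.
by move=> y y0; rewrite w1E ?ltW// mul0r addr0.
Qed.

Let w2E (u : R) : 0 < u -> w2 u = phi * q * f u + A * derive1 f u.
Proof. by move=> u0; rewrite /w2 ext_deriv_pos// (dw1E 1%N). Qed.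

(** As [w2] already contains [f'], its second derivative reaches [f'''], the top order supplied by
    [Cn 3 G]. *)
Let dw2E (u : R) : 0 < u ->
  derive1n 2 w2 u = phi * q * derive1n 2 f u + A * derive1n 3 f u.
Proof.
move=> u0; rewrite (eq_derive1n_pos _ _ 2 w2E)//.
rewrite (derive1n_lin 2 _ _ _ _ _ _ 2 u (leqnn 2) u0).
- by rewrite -derive1Sn.
- exact/(Cn_derivable_pos _ _ (Cn_le _ 3 _ _ Cn_density)).
- move=> k k2 x x0; rewrite -derive1Sn.
  exact: (Cn_derivable_pos _ _ Cn_density).
Qed.

Context (S0 : (sup_norm `[0%R, +oo[ (fun u => u ^+ 2 * (1 - G u))%R < +oo)%E)
  (S : forall i : nat, (1 <= i <= 3)%N ->
    (sup_norm `]0%R, +oo[ (fun u => u ^+ 2 * derive1n i G u)%R < +oo)%E).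

Let Sf : (sup_norm `[0%R, +oo[ (fun u => u ^+ 2 * f u)%R < +oo)%E.
Proof.
(* A plain multiple is treated as a combination of one function with itself, with second coefficient
   0. *)
apply: (sup_norm_lin_lty _ mu^-1 0 _ _ _ S0 S0) => u _.
by rewrite /f; ring.
Qed.

Let Sdf k : (k < 3)%N ->
  (sup_norm `]0%R, +oo[ (fun u => u ^+ 2 * derive1n k.+1 f u)%R < +oo)%E.
Proof.
move=> k3; have Sk := S k.+1 k3.
apply: (sup_norm_lin_lty _ (- mu^-1) 0 _ _ _ Sk Sk) => u /gt0_itvoy u0.
by rewrite derive1n_density//; ring.
Qed.

Lemma sup_norm_w1 : (sup_norm `[0%R, +oo[ (fun u => u ^+ 2 * w1 u)%R < +oo)%E.
Proof.
apply: (sup_norm_lin_lty _ A 0 _ _ _ Sf Sf) => u /=.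
by rewrite in_itv/= andbT => u0; rewrite w1E//; ring.
Qed.

Lemma sup_norm_w2 : (sup_norm `[0%R, +oo[ (fun u => u ^+ 2 * w2 u)%R < +oo)%E.
Proof.
apply: sup_norm_adjoin0_lty.
have Sf0 : (sup_norm `]0%R, +oo[ (fun u => u ^+ 2 * f u)%R < +oo)%E.
  by apply: sup_normS_lty Sf => u /gt0_itvoy u0; rewrite /= in_itv/= ltW.
apply: (sup_norm_lin_lty _ (phi * q) A _ _ _ Sf0 (Sdf 0 isT)) =>
  u /gt0_itvoy u0.
by rewrite w2E// derive1n1; ring.
Qed.

Lemma sup_norm_w1'' :
  (sup_norm `]0%R, +oo[ (fun u => u ^+ 2 * derive1n 2 w1 u)%R < +oo)%E.
Proof.
apply: (sup_norm_lin_lty _ A 0 _ _ _ (Sdf 1 isT) (Sdf 1 isT)) =>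
  u /gt0_itvoy u0.
by rewrite dw1E//; ring.
Qed.

Lemma sup_norm_w2'' :
  (sup_norm `]0%R, +oo[ (fun u => u ^+ 2 * derive1n 2 w2 u)%R < +oo)%E.
Proof.
apply: (sup_norm_lin_lty _ (phi * q) A _ _ _ (Sdf 1 isT) (Sdf 2 isT)) =>
  u /gt0_itvoy u0.
rewrite dw2E//; move: (derive1n 2 f u) (derive1n 3 f u) => a b; ring.
Qed.

End net_claim_functions.

(** Supplies the hypotheses of [second_moment_lty] with [C = mu^-1]: positivity of [mu] makes [f]
    nonincreasing, so each unit increment of the primitive is at most [f n], which is the tail of
    [X] at [n] over [mu]. *)
Lemma variance_tail_density_lty {R : realType}
  {d : measure_display} {T : measurableType d} (P : probability T R)
  (X : {RV P >-> R}) {d' : measure_display} {T' : measurableType d'}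
  (Q : probability T' R) (Z : {RV Q >-> R}) (mu : R) :
  let f (u : R) : R := (1 - fine (cdf X u)) / mu in
  0 < mu -> {within `[0, +oo[, continuous f} ->
  (forall u, cdf Z u = (\int[lebesgue_measure]_(y in `[0%R, u]) f y)%:E) ->
  ('E_P[(fun w => `|X w| ^+ 3)%R] < +oo)%E -> ('V_Q[Z] < +oo)%E.
Proof.
move=> f mu_gt0 cf cdfZ X3.
have mu_ge0 : 0 <= mu := ltW mu_gt0.
apply/variance_lty/(second_moment_lty P X Q Z mu^-1 _ _ _ X3).
- by rewrite invr_ge0.
(* [Z] is almost surely positive: its distribution function at 0 is an integral over one point. *)
- by rewrite [LHS](cdfZ 0) primitive0.
- move=> n; rewrite cdf_itvoc ?ler_nat// !cdfZ.
  have -> : P (X @^-1` `]n%:R, +oo[) = (1 - fine (cdf X n%:R))%:E.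
    rewrite [LHS](ccdf_1_cdf X) EFinB fineK//.
    by rewrite fin_num_measure.
  rewrite -EFinB -EFinM lee_fin.
  apply: (le_trans (primitive_incr_le f cf n%:R n.+1%:R _ _ _)) => //.
  + by rewrite ltr_nat.
  + move=> x y _ _ xy; rewrite /f ler_wpM2r ?invr_ge0// lerD2l lerN2.
    by rewrite fine_le ?fin_num_measure//; exact: cdf_nondecreasing.
  + by rewrite -natr1 addrAC subrr add0r mulr1 mulrC.
Qed.

Theorem proposition3p5
  (R : realType)
  (d : measure_display) (T : measurableType d) (P : probability T R)
  (lambda c : R) (N : R -> {RV P >-> nat}) (X : nat -> {RV P >-> R})
  (d' : measure_display) (T' : measurableType d') (Q : probability T' R)
  (Z : {RV Q >-> R}) :
  let FX : R -> R := fun u => fine (cdf (X 0%N) u) in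
  let mu : R := fine 'E_P[X 0%N] in
  let phi : R := lambda * mu / c in
  let psi : R -> R := ruin_probability c N X in
  let dpsi0 : R := lim (derive1 psi u @[u --> 0^'+]) in
  let f : R -> R := fun u => (1 - FX u) / mu in
  let F : R -> R := fun u =>
    \int[lebesgue_measure]_(y in `[0, u]) f y in
  let v : R -> R := fun u => phi * (1 - F u) in
  let w1 : R -> R := fun u => phi * psi 0 * f u + ext_deriv 1 v u in
  let w2 : R -> R := fun u => phi * dpsi0 * f u + ext_deriv 1 w1 u in
  classical_risk_model lambda c N X ->
  (forall u, cdf Z u = (F u)%:E) ->
  Cn 3 FX ->
  ('E_P[(fun w => `|X 0%N w| ^+ 3)%R] < +oo)%E ->
  cvg (derive1 FX u @[u --> 0^'+]) ->
  (abs_moment 0 (derive1n 2 FX) < +oo)%E ->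
  (abs_moment 2 (derive1n 2 FX) < +oo)%E ->
  (sup_norm `[0%R, +oo[ (fun u => u ^+ 2 * (1 - FX u))%R < +oo)%E ->
  (forall i : nat, (1 <= i <= 3)%N ->
    (sup_norm `]0%R, +oo[ (fun u => u ^+ 2 * derive1n i FX u)%R < +oo)%E) ->
  ('V_Q[Z] < +oo)%E /\
  (Cn0 2 F /\ Cn0 2 v) /\
  (Cn 2 (ext_deriv 1 f) /\ Cn 2 (ext_deriv 2 v)) /\
  ((abs_moment 0 (derive1n 2 f) < +oo)%E /\
   (abs_moment 2 (derive1n 2 f) < +oo)%E) /\
  ((sup_norm `[0%R, +oo[ (fun u => u ^+ 2 * w1 u)%R < +oo)%E /\
   (sup_norm `[0%R, +oo[ (fun u => u ^+ 2 * w2 u)%R < +oo)%E) /\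
  ((sup_norm `]0%R, +oo[ (fun u => u ^+ 2 * derive1n 2 w1 u)%R < +oo)%E /\
   (sup_norm `]0%R, +oo[ (fun u => u ^+ 2 * derive1n 2 w2 u)%R < +oo)%E).
Proof.
move=> FX mu phi psi dpsi0 f F v w1 w2 [_ _ _ _ _ _ _ _ mu_gt0 _].
move=> cdfZ C3FX X3 cvgFX' I0 I2 S0 S.
split.
  apply: variance_tail_density_lty mu_gt0 _ cdfZ X3.
  by case: (Cn_density FX mu C3FX).
split; first by split; [exact: Cn0_distribution|exact: Cn0_tail].
split; first by split; [exact: Cn_density'|exact: Cn_tail''].
split; first by split; exact: abs_moment_density''.
split; first by split; [exact: sup_norm_w1|exact: sup_norm_w2].
by split; [exact: sup_norm_w1''|exact: sup_norm_w2''].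
Qed.
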